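(* Consider the system $$A_s\,\sigma^s(y)+\ldots+A_1\,\sigma(y)+A_0\,y=t^{-\nu}b$$ with $A_0,\ldots,A_s\in\mathbb{K}[t]^{m\times m}$, $b\in\mathbb{K}[t]^m$ and an integer $\nu\geq 0$. For each $j$ let $A_{j0}\in\mathbb{K}^{m\times m}$ denote the coefficient matrix of $t^0$ in $A_j$. Assume that the system is $t$-tail regular, that is, the polynomial $$\lambda=\det\Bigl(\sum_{j=0}^s A_{j0}x^j\Bigr)\in\mathbb{K}[x]$$ is not the zero polynomial. If $y\in\mathbb{K}(t)^m$ is a rational solution of the system and $t^n$ (with $n\geq 0$) is the exact power of $t$ occurring in the denominator of $y$, i.e. the denominator of $y$ is $g\,t^n$ with $g\in\mathbb{K}[t]$ and $t\nmid g$, then 1. $n=0$, or 2. $n\leq\nu$, or 3. $q^{-n}$ is a root of $\lambda$. Consequently, $n$ is bounded by the maximum of the finite set $\{0,\nu\}\cup\{k\in\mathbb{Z}_{\geq 0}:\lambda(q^{-k})=0\}$.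
   Context: $\mathbb{K}$ is a field of characteristic $0$, $q\in\mathbb{K}\setminus\{0\}$ is not a root of unity, and $t$ is an indeterminate over $\mathbb{K}$. The $q$-shift $\sigma$ is the automorphism of the rational function field $\mathbb{K}(t)$ that fixes $\mathbb{K}$ elementwise and satisfies $\sigma(t)=qt$; it acts on column vectors in $\mathbb{K}(t)^m$ component-wise. The denominator of $y\in\mathbb{K}(t)^m$ is the least common denominator of its entries, i.e. a polynomial $d\in\mathbb{K}[t]\setminus\{0\}$ of minimal degree with $dy\in\mathbb{K}[t]^m$. Let $\mathbb{K}(t)[\sigma]$ be the skew polynomial ring of operators in $\sigma$ with coefficients in $\mathbb{K}(t)$ written on the left, with $\sigma f=\sigma(f)\sigma$ for $f\in\mathbb{K}(t)$. Standing assumption: the matrix $A_s\sigma^s+\ldots+A_0$ has full (left row) rank over $\mathbb{K}(t)[\sigma]$, i.e. its rows are left linearly independent over $\mathbb{K}(t)[\sigma]$. *)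

(* Defs.v *)
From HB Require Import structures.
From mathcomp Require Import all_boot all_order all_algebra.

Set Implicit Arguments.
Unset Strict Implicit.
Unset Printing Implicit Defensive.

Import GRing.Theory.
Local Open Scope ring_scope.

Notation "p %:F" := (FracField.tofrac p) : ring_scope.

Lemma frac_eq (R : idomainType) (a b c d : R) : b != 0 -> d != 0 ->
  (a%:F / b%:F == c%:F / d%:F) = (a * d == c * b).
Proof.
rewrite -(tofrac_eq0 b) -(tofrac_eq0 d) -(tofrac_eq (a * d)) !tofracM.
exact: eqr_div.
Qed.

Section QShift.
Variables (K : fieldType) (q : K).
Hypothesis q_neq0 : q != 0.
Local Notation F := {fraction {poly K}}.

Definition qsubst (p : {poly K}) : {poly K} := p \Po (q *: 'X).

(* By [qshift_frac] the value does not depend on the representative; the proof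
   of [q != 0] is an argument so that [qshift] is a ring morphism. *)
Definition qshift of q != 0 := fun f : F =>
  (qsubst \n_(repr f))%:F / (qsubst \d_(repr f))%:F.

Lemma qsubst_eq0 (p : {poly K}) : (qsubst p == 0) = (p == 0).
Proof.
apply/eqP/eqP=> [h|->]; last by rewrite /qsubst comp_poly0.
have : qsubst p \Po (q^-1 *: 'X) = 0 by rewrite h comp_poly0.
by rewrite /qsubst -comp_polyA comp_polyZ comp_polyX scalerA divff // scale1r
           comp_polyXr.
Qed.

Lemma frac_repr (f : F) : f = (\n_(repr f))%:F / (\d_(repr f))%:F.
Proof.
have dn0 := denom_ratioP (repr f).
have dF0 : (\d_(repr f))%:F != 0 :> F by rewrite tofrac_eq0.
apply: (mulIf dF0); rewrite divfK //.
rewrite -{1}[f]reprK; move: (repr f) dn0 => x dn0.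
rewrite -[LHS]/(FracField.mul _ _); unlock FracField.tofrac.
rewrite -FracField.pi_mul; apply/eqP; rewrite FracField.equivf_def.
rewrite /FracField.mulf !numden_Ratio ?mulr1 ?mul1r ?oner_neq0 //.
by rewrite mulrC.
Qed.

Lemma qshift_frac (n d : {poly K}) : d != 0 ->
  qshift q_neq0 (n%:F / d%:F) = (qsubst n)%:F / (qsubst d)%:F.
Proof.
move=> d0; rewrite /qshift; set f := n%:F / d%:F.
have := frac_repr f; have := denom_ratioP (repr f).
move: (\n_ _) (\d_ _) => n' d' d'0 e.
have {}e : n * d' = n' * d.
  by apply/eqP; rewrite -frac_eq // -/f e.
by apply/eqP; rewrite frac_eq ?qsubst_eq0 // /qsubst -!comp_polyM e.
Qed.

Lemma qshift_tofrac (p : {poly K}) : qshift q_neq0 p%:F = (qsubst p)%:F.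
Proof.
rewrite -[p%:F]divr1 -tofrac1 qshift_frac ?oner_neq0 //.
by rewrite /qsubst [X in _ / X%:F]comp_polyC tofrac1 divr1.
Qed.

Fact qshift_is_zmod_morphism : zmod_morphism (qshift q_neq0).
Proof.
move=> f g; rewrite (frac_repr f) (frac_repr g).
have := denom_ratioP (repr f); have := denom_ratioP (repr g).
move: (\n_(repr f)) (\d_(repr f)) (\n_(repr g)) (\d_(repr g)) => a b c d d0 b0.
rewrite -mulNr addf_div ?tofrac_eq0 // -tofracN -!tofracM -tofracD.
rewrite !qshift_frac ?mulf_neq0 // -mulNr addf_div ?tofrac_eq0 ?qsubst_eq0 //.
by rewrite -tofracN -!tofracM -tofracD /qsubst !comp_polyD !comp_polyM -!scaleN1r comp_polyZ.
Qed.

Fact qshift_is_monoid_morphism : monoid_morphism (qshift q_neq0).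
Proof.
split=> [|f g]; first by rewrite -tofrac1 qshift_tofrac /qsubst comp_polyC.
rewrite (frac_repr f) (frac_repr g).
have := denom_ratioP (repr f); have := denom_ratioP (repr g).
move: (\n_(repr f)) (\d_(repr f)) (\n_(repr g)) (\d_(repr g)) => a b c d d0 b0.
rewrite mulf_div -!tofracM !qshift_frac ?mulf_neq0 // mulf_div -!tofracM.
by rewrite /qsubst !comp_polyM.
Qed.

HB.instance Definition _ :=
  GRing.isZmodMorphism.Build F F (qshift q_neq0) qshift_is_zmod_morphism.
HB.instance Definition _ :=
  GRing.isMonoidMorphism.Build F F (qshift q_neq0) qshift_is_monoid_morphism.

Lemma qshiftC (c : K) : qshift q_neq0 c%:P%:F = c%:P%:F.
Proof. by rewrite qshift_tofrac /qsubst comp_polyC. Qed.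

Lemma qshiftX : qshift q_neq0 'X%:F = (q *: 'X)%:F.
Proof. by rewrite qshift_tofrac /qsubst comp_polyX. Qed.

End QShift.

Lemma qshiftK (K : fieldType) (q : K) (q_neq0 : q != 0) (qV_neq0 : q^-1 != 0) :
  cancel (qshift q_neq0) (qshift qV_neq0).
Proof.
have qsK p : qsubst q^-1 (qsubst q p) = p.
  by rewrite /qsubst -comp_polyA comp_polyZ comp_polyX scalerA divff //
             scale1r comp_polyXr.
move=> f; rewrite [f in RHS]frac_repr [qshift q_neq0 f]/qshift.
by rewrite qshift_frac ?qsK // (qsubst_eq0 q_neq0) denom_ratioP.
Qed.

Lemma qshift_bij (K : fieldType) (q : K) (q_neq0 : q != 0) :
  bijective (qshift q_neq0).
Proof.
have qV_neq0 : q^-1 != 0 by rewrite invr_eq0.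
exists (qshift qV_neq0); first exact: qshiftK.
have qVV_neq0 : q^-1^-1 != 0 by rewrite invrK.
move=> f; rewrite -[RHS](qshiftK qV_neq0 qVV_neq0); move: qVV_neq0.
by rewrite invrK => h; rewrite (bool_irrelevance h q_neq0).
Qed.

(* The coefficient of sigma ^ i is the i-th entry; coefficients are written on
   the left and sigma * a = sigma(a) * sigma. *)
Definition skew_poly (F : nzRingType) (sigma : {rmorphism F -> F}) := {poly F}.

HB.instance Definition _ (F : nzRingType) (sigma : {rmorphism F -> F}) :=
  GRing.Zmodule.on (skew_poly sigma).

Section SkewPoly.
Variables (F : nzRingType) (sigma : {rmorphism F -> F}).
Implicit Types p r u : {poly F}.

Definition skew_mul p r : {poly F} :=
  \poly_(k < (size p + size r).-1)
     \sum_(i < k.+1) p`_i * iter i sigma r`_(k - i).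

Lemma iter_sigma0 i : iter i sigma 0 = 0.
Proof. by elim: i => //= i ->; rewrite rmorph0. Qed.

Lemma iter_sigma1 i : iter i sigma 1 = 1.
Proof. by elim: i => //= i ->; rewrite rmorph1. Qed.

Lemma iter_sigmaD i : {morph iter i sigma : a b / a + b}.
Proof. by elim: i => // i IH a b; rewrite !iterS IH rmorphD. Qed.

Lemma iter_sigmaM i : {morph iter i sigma : a b / a * b}.
Proof. by elim: i => // i IH a b; rewrite !iterS IH rmorphM. Qed.

Lemma iter_sigma_sum i n (f : 'I_n -> F) :
  iter i sigma (\sum_j f j) = \sum_j iter i sigma (f j).
Proof. exact: (big_morph _ (iter_sigmaD i) (iter_sigma0 i)). Qed.

Lemma coef_skew_mul p r k :
  (skew_mul p r)`_k = \sum_(i < k.+1) p`_i * iter i sigma r`_(k - i).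
Proof.
rewrite coef_poly -subn1 ltn_subRL add1n; case: leqP => // le_pq_k1.
rewrite big1 // => i _; have [lepi|ltip] := leqP (size p) i.
  by rewrite nth_default ?mul0r.
rewrite [r`_ _]nth_default ?iter_sigma0 ?mulr0 //.
rewrite -(leq_add2l i) subnKC; last by rewrite -ltnS.
by rewrite -ltnS; apply: leq_trans le_pq_k1; rewrite ltn_add2r.
Qed.

Fact skew_mulA : associative skew_mul.
Proof.
move=> p r u; apply/polyP=> k; rewrite !coef_skew_mul.
pose G (i j : nat) := p`_i * iter i sigma r`_(j - i) * iter j sigma u`_(k - j).
transitivity (\sum_(i < k.+1) \sum_(j < k.+1 | (i <= j)%N) G i j).
  apply: eq_bigr => i _; rewrite coef_skew_mul iter_sigma_sum big_distrr /=.
  transitivity (\sum_(0 + i <= j < k.+1) G i j); last first.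
    by rewrite add0n big_geq_mkord.
  rewrite big_addn big_mkord subSn -1?ltnS //; apply: eq_bigr => j _.
  by rewrite /G addnK iter_sigmaM mulrA -iterD [(j + i)%N]addnC subnDA.
rewrite (exchange_big_dep predT) //=; apply: eq_bigr => j _.
rewrite coef_skew_mul big_distrl /=.
by rewrite (big_ord_widen_cond k.+1 predT (fun i => G i j)) //; apply: eq_bigl.
Qed.

Fact skew_mul1l : left_id 1 skew_mul.
Proof.
move=> p; apply/polyP=> k; rewrite coef_skew_mul big_ord_recl coef1 mul1r subn0.
by rewrite big1 ?addr0 // => i _; rewrite coef1 mul0r.
Qed.

Fact skew_mul1r : right_id 1 skew_mul.
Proof.
move=> p; apply/polyP=> k; rewrite coef_skew_mul big_ord_recr /= subnn coef1.
rewrite iter_sigma1 mulr1 big1 ?add0r // => i _.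
by rewrite coef1 subn_eq0 leqNgt ltn_ord iter_sigma0 mulr0.
Qed.

Fact skew_mulDl : left_distributive skew_mul +%R.
Proof.
move=> p r u; apply/polyP=> k; rewrite coefD !coef_skew_mul -big_split.
by apply: eq_bigr => i _; rewrite coefD mulrDl.
Qed.

Fact skew_mulDr : right_distributive skew_mul +%R.
Proof.
move=> p r u; apply/polyP=> k; rewrite coefD !coef_skew_mul -big_split.
by apply: eq_bigr => i _; rewrite coefD iter_sigmaD mulrDr.
Qed.

HB.instance Definition _ := GRing.Zmodule_isNzRing.Build (skew_poly sigma)
  skew_mulA skew_mul1l skew_mul1r skew_mulDl skew_mulDr (oner_neq0 {poly F}).

Definition skewC (a : F) : skew_poly sigma := a%:P.
Definition skewX : skew_poly sigma := 'X.

Lemma skewX_C (a : F) : skewX * skewC a = skewC (sigma a) * skewX.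
Proof.
apply/polyP=> k; rewrite !coef_skew_mul; case: k => [|k].
  by rewrite !big_ord1 /= subnn !coefX !coefC /= mul0r mulr0.
rewrite !big_ord_recl big1 => [|i _]; last by rewrite coefX mul0r.
rewrite big1 => [|i _]; last by rewrite !coefC mul0r.
by rewrite !coefX !coefC /= !subSS !subn0; case: k => [|k];
   rewrite /= ?mul0r ?mul1r ?mulr1 ?mulr0 ?rmorph0 ?add0r ?addr0.
Qed.

End SkewPoly.

Section System.
Variables (K : fieldType) (q : K) (q_neq0 : q != 0) (m s : nat).
Local Notation F := {fraction {poly K}}.

Definition qop := skew_poly (qshift q_neq0 : {rmorphism F -> F}).

(* The matrix A_s sigma^s + ... + A_0. *)
Definition system_op (A : 'I_s.+1 -> 'M[{poly K}]_m) : 'M[qop]_m :=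
  \matrix_(i, j) \sum_(k < s.+1) skewC _ (A k i j)%:F * skewX _ ^+ k.

Definition full_left_row_rank (P : 'M[qop]_m) : Prop :=
  forall c : 'rV[qop]_m, c *m P = 0 -> c = 0.

Definition is_solution (A : 'I_s.+1 -> 'M[{poly K}]_m) (b : 'cV[{poly K}]_m)
    (nu : nat) (y : 'cV[F]_m) : Prop :=
  \sum_(j < s.+1) map_mx (@FracField.tofrac _) (A j)
                    *m map_mx (iter j (qshift q_neq0)) y
  = ('X%:F ^- nu) *: map_mx (@FracField.tofrac _) b.

Definition tail_poly (A : 'I_s.+1 -> 'M[{poly K}]_m) : {poly K} :=
  \det (\sum_(j < s.+1) 'X^j *: map_mx polyC (map_mx (coefp 0) (A j))).

End System.

Definition clears_denom (K : fieldType) (m : nat) (d : {poly K})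
    (y : 'cV[{fraction {poly K}}]_m) : Prop :=
  exists p : 'cV[{poly K}]_m, d%:F *: y = map_mx (@FracField.tofrac _) p.

(* Determined up to a nonzero constant factor; no normalisation is imposed. *)
Definition is_denom (K : fieldType) (m : nat) (d : {poly K})
    (y : 'cV[{fraction {poly K}}]_m) : Prop :=
  [/\ d != 0, clears_denom d y &
      forall e : {poly K}, e != 0 -> clears_denom e y -> (size d <= size e)%N].

(* Main.v *)
(* If [t^n] with [n > nu] divides the denominator [d = g t^n] of [y = p / d],
   multiply the system by [t^n] times the product of the shifts of [g]: since
   [sigma^j (t^n) = q^(j n) t^n], evaluating at [t = 0] gives
   [(sum_j A_{j0} q^(- j n)) p(0) = 0], and [p(0) <> 0] because otherwise [t]
   could be cancelled from [d] and [p]. Hence [q^-n] is a root of [lambda]. *)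
Require Import Defs.
From HB Require Import structures.
From mathcomp Require Import all_boot all_order all_algebra.
From Stdlib Require Import Classical.

Set Implicit Arguments.
Unset Strict Implicit.
Unset Printing Implicit Defensive.

Import GRing.Theory.
Local Open Scope ring_scope.

(** If [q ^+ j = q ^+ k] with [j < k], cancelling [q ^+ j] makes [q] a root of unity of order
    dividing [k - j]. *)
Lemma expf_inj (K : fieldType) (q : K) : q != 0 ->
  (forall k : nat, (0 < k)%N -> ~~ k.-unity_root q) -> injective (GRing.exp q).
Proof.
move=> q0 qU.
suff lt_neq j k : (j < k)%N -> q ^+ j != q ^+ k.
  move=> j k /eqP; case: (ltngtP j k) => // /lt_neq /negPf; first by move=> ->.
  by rewrite eq_sym => ->.
move=> ltjk; apply/eqP => eqjk; have kj0 : (0 < k - j)%N by rewrite subn_gt0.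
move/negP: (qU _ kj0); apply; apply/unity_rootP.
apply: (mulfI (expf_neq0 j q0)).
by rewrite -exprD subnKC 1?ltnW // mulr1.
Qed.

(** Induction on the size of [p]: split off a linear factor at some root [f k]. By injectivity [k]
    is the only index this factor accounts for, and all others belong to the smaller quotient. It is
    used to make the set of exponents in the final bound finite. *)
Lemma injective_roots_bounded (K : fieldType) (f : nat -> K) (p : {poly K}) :
  injective f -> p != 0 -> exists N, forall k, root p (f k) -> (k <= N)%N.
Proof.
move=> f_inj; have [n] := ubnP (size p); elim: n p => // n IH p lepn p0.
(* The existence of a root among infinitely many values [f k] is decided by excluded middle. *)
have [[k rk]|nroot] := classic (exists k, root p (f k)); last first.
  by exists 0%N => k rk; case: nroot; exists k.
have /factor_theorem [r Dp] := rk.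
have r0 : r != 0 by apply: contraNneq p0 => r0; rewrite Dp r0 mul0r.
have [|//|N ubN] := IH r.
  by move: lepn; rewrite Dp size_Mmonic ?monicXsubC // size_XsubC addn2.
exists (maxn N k) => l; rewrite Dp rootM root_XsubC leq_max.
by case/orP=> [/ubN->//|/eqP/f_inj->]; rewrite leqnn orbT.
Qed.

Section Tail.
Variables (K : fieldType) (q : K) (q_neq0 : q != 0).
Local Notation F := {fraction {poly K}}.

Lemma iter_qshift_tofrac j (p : {poly K}) :
  iter j (qshift q_neq0) p%:F = (p \Po (q ^+ j *: 'X))%:F.
Proof.
elim: j => [|j IH]; first by rewrite expr0 scale1r comp_polyXr.
rewrite iterS IH qshift_tofrac /qsubst -comp_polyA comp_polyZ comp_polyX.
by rewrite scalerA -exprSr.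
Qed.

Lemma horner0_comp_scaleX (c : K) (p : {poly K}) :
  (p \Po (c *: 'X)).[0] = p.[0].
Proof. by rewrite horner_comp hornerZ hornerX mulr0. Qed.

(** Apply the multiplicative map sigma^j, which substitutes q^j t for t in polynomials, to both
    sides of d y = p. *)
Lemma iter_qshift_clears m (d : {poly K}) (y : 'cV[F]_m) (p : 'cV[{poly K}]_m)
    (j : nat) : d%:F *: y = map_mx (@FracField.tofrac _) p ->
  (d \Po (q ^+ j *: 'X))%:F *: map_mx (iter j (qshift q_neq0)) y =
  map_mx (@FracField.tofrac _)
    (map_mx (fun u => u \Po (q ^+ j *: 'X)) p).
Proof.
move=> dy; apply/colP=> i; rewrite !mxE -!iter_qshift_tofrac -iter_sigmaM.
by move/colP/(_ i): dy; rewrite !mxE => ->.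
Qed.

(** If p(0) = 0, then t divides every entry of p. Cancelling one t shows that g t^(n-1) already
    clears y, against the minimality of the degree of the denominator. *)
Lemma denom_numerator_neq0 m (g : {poly K}) (n : nat) (y : 'cV[F]_m)
    (p : 'cV[{poly K}]_m) :
  (0 < n)%N -> is_denom (g * 'X^n) y ->
  (g * 'X^n)%:F *: y = map_mx (@FracField.tofrac _) p ->
  map_mx (horner_eval 0) p != 0.
Proof.
case: n => // n _ [d0 _ dmin] dy; apply/eqP => p0.
have g0 : g * 'X^n != 0.
  by apply: contraNneq d0 => gXn; rewrite exprSr mulrA gXn mul0r.
have X0 : 'X%:F != 0 :> F by rewrite tofrac_eq0 polyX_eq0.
have Dp i : p i 0 = p i 0 %/ 'X * 'X.
  rewrite divpK // -['X]subr0 dvdp_XsubCl.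
  by move/colP/(_ i): p0; rewrite !mxE => /eqP.
have := dmin _ g0; rewrite exprSr mulrA size_mulX // ltnn => /(_ _).
suff H : clears_denom (g * 'X^n) y by move/(_ H).
exists (map_mx (fun u => u %/ 'X) p); apply/colP=> i; apply: (mulIf X0).
rewrite !mxE -tofracM -Dp mulrAC -tofracM -mulrA -exprSr.
by move/colP/(_ i): dy; rewrite !mxE.
Qed.

(** Evaluation is a ring morphism, so it commutes with the determinant; the coefficient of t^0 is
    the value at t = 0. *)
Lemma horner_tail_poly m s (A : 'I_s.+1 -> 'M[{poly K}]_m) (x : K) :
  (tail_poly A).[x] =
  \det (\sum_(j < s.+1) x ^+ j *: map_mx (horner_eval 0) (A j)).
Proof.
rewrite -/(horner_eval x _) /tail_poly -det_map_mx; congr (\det _).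
apply/matrixP=> i k; rewrite !mxE !summxE rmorph_sum /=; apply: eq_bigr => j _.
rewrite !mxE rmorphM rmorphXn /= /horner_eval hornerX hornerC.
by rewrite -horner_coef0.
Qed.

Lemma root_tail_poly m s nu (A : 'I_s.+1 -> 'M[{poly K}]_m)
    (b : 'cV[{poly K}]_m) (y : 'cV[F]_m) (g : {poly K}) (n : nat) :
  is_solution q_neq0 A b nu y -> is_denom (g * 'X^n) y -> ~~ ('X %| g) ->
  (0 < n)%N -> (nu < n)%N -> root (tail_poly A) (q ^- n).
Proof.
move=> sol den Xg n0 nun; have [d0 [p dy] _] := den.
have p0 := denom_numerator_neq0 n0 den dy.
have X0 : 'X%:F != 0 :> F by rewrite tofrac_eq0 polyX_eq0.
have g0 : g.[0] != 0 by rewrite -['X]subr0 dvdp_XsubCl in Xg.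
(* [gs j] is sigma^j(g), so G t^n is a common denominator of all the shifts of y. *)
pose gs j := g \Po (q ^+ j *: 'X).
pose G := \prod_(j < s.+1) gs j.
pose G' (j : 'I_s.+1) := \prod_(i < s.+1 | i != j) gs i.
(* The numerator of sigma^j(y) over G t^n: the cofactor [G' j] completes sigma^j(g) to G, and
   q^(-jn) compensates sigma^j(t^n) = q^(jn) t^n. *)
pose c (j : 'I_s.+1) : 'cV[{poly K}]_m :=
  \col_i (((q ^- n) ^+ j)%:P * G' j * (p i 0 \Po (q ^+ j *: 'X))).
have Gy (j : 'I_s.+1) : (G * 'X^n)%:F *: map_mx (iter j (qshift q_neq0)) y =
    map_mx (@FracField.tofrac _) (c j).
  have -> : G * 'X^n =
      ((q ^- n) ^+ j)%:P * G' j * ((g * 'X^n) \Po (q ^+ j *: 'X)).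
    rewrite comp_polyM comp_Xn_poly exprZn -/(gs j) -[_ *: 'X^n]mul_polyC.
    rewrite (mulrCA (gs j)) mulrACA -polyCM exprVn -!exprM (mulnC j).
    by rewrite mulVf ?expf_neq0 // mul1r mulrA /G (bigD1 j) //= (mulrC (gs j)).
  rewrite tofracM -scalerA (iter_qshift_clears j dy).
  by apply/colP=> i; rewrite !mxE !tofracM.
have polyeq : \sum_(j < s.+1) A j *m c j = (G * 'X^(n - nu)) *: b.
  (* The embedding of polynomials into fractions is injective, so the identity may be checked there,
     where it is the system multiplied by G t^n. *)
  suff H : map_mx (@FracField.tofrac _) (\sum_(j < s.+1) A j *m c j) =
           map_mx (@FracField.tofrac _) ((G * 'X^(n - nu)) *: b).
    apply/colP=> i; apply/eqP; rewrite -tofrac_eq.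
    by move/colP/(_ i): H; rewrite !mxE => ->.
  have /= {sol} := congr1 ( *:%R (G * 'X^n)%:F) sol.
  rewrite scaler_sumr scalerA.
  have -> : (G * 'X^n)%:F / 'X%:F ^+ nu = (G * 'X^(n - nu))%:F.
    apply: (mulIf (expf_neq0 nu X0)); rewrite divfK ?expf_neq0 //.
    by rewrite -tofracXn -tofracM -mulrA -exprD subnK // ltnW.
  move=> sol.
  rewrite map_mxZ -sol map_mx_sum; apply: eq_bigr => j _.
  by rewrite map_mxM /= -Gy scalemxAr.
have ev : (\sum_(j < s.+1) (q ^- n) ^+ j *: map_mx (horner_eval 0) (A j))
          *m map_mx (horner_eval 0) p = 0.
  (* At t = 0 each of the s factors of [G' j] takes the value g(0), so every term carries the same
     nonzero factor g(0)^s. *)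
  apply: (scalerI (expf_neq0 s g0)); rewrite scaler0.
  (* The right-hand side keeps a positive power of t because [nu < n]. *)
  have G0 : horner_eval 0 (G * 'X^(n - nu)) = 0.
    rewrite /horner_eval hornerM hornerXn.
    by rewrite expr0n subn_eq0 leqNgt nun mulr0.
  move/(congr1 (map_mx (horner_eval 0))): polyeq.
  rewrite map_mxZ /= G0 scale0r => <-.
  rewrite map_mx_sum mulmx_suml scaler_sumr; apply: eq_bigr => j _.
  rewrite map_mxM -scalemxAl scalerA scalemxAr; congr (_ *m _).
  apply/colP=> i; rewrite !mxE /= /horner_eval.
  rewrite !hornerM hornerC horner0_comp_scaleX.
  rewrite horner_prod (eq_bigr (fun=> g.[0])); last first.
    by move=> k _; rewrite horner0_comp_scaleX.
  by rewrite prodr_const cardC1 card_ord (mulrC (g.[0] ^+ s)).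
(* [det0P] asks for a row vector in the left kernel, whereas p(0) lies in the right kernel; hence
   the transposes. *)
rewrite rootE horner_tail_poly -det_tr; apply/det0P.
exists (map_mx (horner_eval 0) p)^T.
  by rewrite -(inj_eq trmx_inj) trmxK trmx0.
by rewrite -trmx_mul ev trmx0.
Qed.

End Tail.

Theorem theorem2p2 (K : fieldType) (charK0 : [pchar K] =i pred0)
  (q : K) (q_neq0 : q != 0)
  (q_not_root_of_unity : forall k : nat, (0 < k)%N -> ~~ k.-unity_root q)
  (m s nu : nat) (A : 'I_s.+1 -> 'M[{poly K}]_m) (b : 'cV[{poly K}]_m)
  (full_rank : full_left_row_rank (system_op q_neq0 A))
  (tail_regular : tail_poly A != 0) :
  exists S : seq nat,
    (forall k : nat,
       k \in S <-> [\/ k = 0%N, k = nu | root (tail_poly A) (q ^- k)]) /\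
    forall (y : 'cV[{fraction {poly K}}]_m) (g : {poly K}) (n : nat),
      is_solution q_neq0 A b nu y ->
      is_denom (g * 'X^n) y -> ~~ ('X %| g)%R ->
      [\/ n = 0%N, (n <= nu)%N | root (tail_poly A) (q ^- n)] /\
      (n <= \max_(k <- S) k)%N.
Proof.
have qV_inj : injective (fun k => q ^- k).
  by move=> j k /invr_inj; apply: expf_inj q_neq0 q_not_root_of_unity j k.
have [N ubN] := injective_roots_bounded qV_inj tail_regular.
(* Searching up to [N] inclusive finds every exponent that gives a root. *)
pose S := 0%N :: nu :: [seq k <- iota 0 N.+1 | root (tail_poly A) (q ^- k)].
have memS k : k \in S <-> [\/ k = 0%N, k = nu | root (tail_poly A) (q ^- k)].
  rewrite !inE mem_filter mem_iota; split.
    by case/or3P=> [/eqP|/eqP|/andP[]];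
      [constructor 1|constructor 2|constructor 3].
  case=> [->|->|rk]; rewrite ?eqxx ?orbT //.
  by rewrite rk ltnS ubN // !orbT.
have le_max k : k \in S -> (k <= \max_(i <- S) i)%N.
  by move=> kS; apply: leq_bigmax_seq.
exists S; split=> // y g n sol den Xg.
have [->|n0] := posnP n; first by split=> //; constructor 1.
have [lenu|nun] := leqP n nu.
  split; first by constructor 2.
  by apply: leq_trans lenu _; apply/le_max/memS; constructor 2.
have rn := root_tail_poly sol den Xg n0 nun.
by split; [constructor 3|apply/le_max/memS; constructor 3].
Qed.
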